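(* Let $\rho$ be a self-conjugate irreducible representation of $S_d$ and let $r(\rho)$ be the length of the main diagonal of its Young diagram. Let $$\varepsilon_\rho=(-1)^{o(\rho)},\qquad o(\rho)=\sum_{\beta\vdash d,\ \beta\ \mathrm{odd}}\frac{\chi_\rho(sq(\beta))}{\zeta(\beta)}.$$ Then $\varepsilon_\rho=(-1)^{\frac{d-r(\rho)}2}$.
   Context: Irreducible representations of $S_d$ are indexed by partitions (Young diagrams) of $d$; $\rho$ is self-conjugate if its Young diagram is invariant under transposition, equivalently $\rho\cong\rho\otimes\mathrm{sign}$. $\chi_\rho(\alpha)$ is the trace of $\rho$ on the conjugacy class of cycle type $\alpha$. A partition $\beta\vdash d$ is odd if $d-\ell(\beta)$ is odd ($\ell(\beta)$ the number of parts). $sq(\beta)$ is the partition of $d$ obtained from $\beta$ by splitting each even part into two equal parts (the cycle type of $g^2$ when $g$ has cycle type $\beta$). $\zeta(\beta)=\prod_k m_k!\,k^{m_k}$ for $\beta=(1^{m_1}2^{m_2}\dots)$. On a self-conjugate irreducible representation, $o(\rho)\in\{0,1\}$. *)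

(* Defs.v *)
From HB Require Import structures.
From mathcomp Require Import all_boot all_order all_algebra.
From mathcomp Require Import all_fingroup all_field all_character.

Set Implicit Arguments.
Unset Strict Implicit.
Unset Printing Implicit Defensive.

Import GroupScope GRing.Theory Num.Theory.
Local Open Scope ring_scope.

Definition is_intpart (d : nat) (s : seq nat) : bool :=
  [&& sorted geq s, 0%N \notin s & sumn s == d].

(** [intpart d] is the type of partitions of [d], a partition being the weakly
    decreasing sequence of its (positive) parts. *)
Record intpart (d : nat) := IntPart {
  parts :> seq nat;
  partsP : is_intpart d parts
}.

HB.instance Definition _ d := [isSub for @parts d].
HB.instance Definition _ d := [Countable of intpart d by <:].

Lemma size_parts d (lam : intpart d) : (size lam <= d)%N.
Proof.
case: lam => s /= /and3P[_ s0 /eqP <-].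
elim: s s0 => //= k s IHs; rewrite inE negb_or eq_sym -lt0n => /andP[k0 /IHs].
by rewrite -add1n; apply: leq_add.
Qed.

Lemma leq_part d (lam : intpart d) i : (nth 0%N lam i <= d)%N.
Proof.
have [ge_i|lt_i] := leqP (size lam) i; first by rewrite nth_default.
case/and3P: (partsP lam) => _ _ /eqP sum_lam.
rewrite -[leqRHS]sum_lam sumnE.
by rewrite (big_nth 0%N) big_mkord (bigD1 (Ordinal lt_i)) //= leq_addr.
Qed.

Definition intpart_ffun d (lam : intpart d) : {ffun 'I_d -> 'I_d.+1} :=
  [ffun i : 'I_d => inord (nth 0%N lam i)].

Definition ffun_intpart d (f : {ffun 'I_d -> 'I_d.+1}) : option (intpart d) :=
  insub [seq k <- [seq val (f i) | i <- enum 'I_d] | k != 0%N].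

Lemma intpart_ffunK d : pcancel (@intpart_ffun d) (@ffun_intpart d).
Proof.
move=> lam; rewrite /ffun_intpart.
have -> : [seq val (intpart_ffun lam i) | i <- enum 'I_d]
          = mkseq (nth 0%N lam) d.
  rewrite /mkseq -val_enum_ord -map_comp; apply: eq_map => i /=.
  by rewrite ffunE inordK // ltnS leq_part.
have -> : mkseq (nth 0%N lam) d = lam ++ nseq (d - size lam) 0%N.
  apply: (@eq_from_nth _ 0%N) => [|i].
    by rewrite size_mkseq size_cat size_nseq subnKC // size_parts.
  rewrite size_mkseq => lt_id; rewrite nth_mkseq // nth_cat nth_nseq if_same.
  by case: ltnP => // ge_i; rewrite nth_default.
rewrite filter_cat filter_nseq /= cats0.
have /all_filterP -> : all (fun k => k != 0%N) lam.
  apply/allP => k k_lam; case/and3P: (partsP lam) => _ n0 _.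
  by apply: contraNneq n0 => <-.
by rewrite valK.
Qed.

HB.instance Definition _ d : isFinite (intpart d) :=
  PCanIsFinite (@intpart_ffunK d).

(** * Young diagrams *)

Definition in_diagram d (lam : intpart d) (i j : nat) : bool :=
  (j < nth 0 lam i)%N.

Definition self_conjugate d (lam : intpart d) : Prop :=
  forall i j : nat, in_diagram lam i j = in_diagram lam j i.

Definition diag_length d (lam : intpart d) : nat :=
  count (fun i => in_diagram lam i i) (iota 0 (size lam)).

(** The row and the column of the box with entry [k] in the tableau of shape
    [lam] obtained by writing 0, ..., d-1 along the successive rows. *)
Definition tableau_row d (lam : intpart d) (k : 'I_d) : nat :=
  reshape_index lam k.
Definition tableau_col d (lam : intpart d) (k : 'I_d) : nat :=
  reshape_offset lam k.

(** Halving [d - diag_length lam] is exact on self-conjugate diagrams. *)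
Lemma diag_parity d (lam : intpart d) : self_conjugate lam ->
  (diag_length lam <= d)%N && ~~ odd (d - diag_length lam).
Proof.
move=> sc_lam; pose M (P : rel nat) :=
  (\sum_(i < d) \sum_(j < d) (in_diagram lam i j && P i j))%N.
have M_sym P : M P = M (fun i j => P j i).
  rewrite /M exchange_big; apply: eq_bigr => i _; apply: eq_bigr => j _.
  by rewrite sc_lam.
have Md : M (fun _ _ => true) = d.
  case/and3P: (partsP lam) => _ _ /eqP sum_lam.
  rewrite -[RHS]sum_lam sumnE (big_nth 0%N) big_mkord /M.
  rewrite (big_ord_widen d (fun i => nth 0%N lam i)) ?size_parts //.
  rewrite [RHS]big_mkcond; apply: eq_bigr => i _.
  transitivity (nth 0%N lam i); last first.
    by case: ltnP => // ?; rewrite nth_default.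
  under eq_bigr do rewrite andbT.
  rewrite -[RHS]subn0 -[RHS]muln1 -sum_nat_const_nat big_mkord.
  rewrite (big_ord_widen d (fun=> 1%N)) ?leq_part // [RHS]big_mkcond /=.
  by apply: eq_bigr => j _; rewrite /in_diagram; case: ltnP.
have Mr : M (fun i j => i == j) = diag_length lam.
  rewrite /diag_length -sum1_count big_mkcond /=.
  rewrite -[size lam]subn0 -/(index_iota 0 _) big_mkord.
  rewrite (big_ord_widen d (fun i => if in_diagram lam i i then 1 else 0)%N)
    ?size_parts // [RHS]big_mkcond /=; apply: eq_bigr => i _.
  rewrite (bigD1 i) //= eqxx andbT big1 ?addn0 => [|j ne_ji].
    by case: ltnP => // ?; rewrite /in_diagram nth_default.
  by rewrite [(_ == _)](_ : _ = false) ?andbF // eq_sym; apply: negPf.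
have M3 : M (fun _ _ => true) =
    (M (fun i j => i == j) + (M (fun i j => i < j)%N + M (fun i j => j < i)%N))%N.
  rewrite /M -!big_split; apply: eq_bigr => i _ /=.
  rewrite -!big_split; apply: eq_bigr => j _ /=.
  by case: (in_diagram lam i j) => //=; case: ltngtP.
rewrite Md Mr (M_sym (fun i j => j < i)%N) /= addnn in M3.
by rewrite [X in (_ <= X)%N]M3 [X in (X - _)%N]M3 leq_addr addKn odd_double.
Qed.

(** * Specht modules *)

Definition row_group d (lam : intpart d) : {set 'S_d} :=
  [set g : 'S_d | [forall k, tableau_row lam (g k) == tableau_row lam k]].
Definition col_group d (lam : intpart d) : {set 'S_d} :=
  [set g : 'S_d | [forall k, tableau_col lam (g k) == tableau_col lam k]].

(** The Young symmetrizer a_lam b_lam, as an element of the group algebra, whose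
    elements are encoded as matrices by the regular representation. *)
Definition young_symmetrizer d (lam : intpart d) : 'M[algC]_#|[set: 'S_d]| :=
  let aG := regular_repr algC [set: 'S_d] in
  (\sum_(g in row_group lam) aG g)
    *m (\sum_(g in col_group lam) (-1) ^+ odd_perm g *: aG g).

(** [gring_row] sends an element of the group algebra to its row vector of
    coordinates, and the regular representation acts on these by right
    multiplication; so this is the right ideal generated by the symmetrizer. *)
Definition specht_mx d (lam : intpart d) : 'M[algC]_#|[set: 'S_d]| :=
  cyclic_mx (regular_repr algC [set: 'S_d]) (gring_row (young_symmetrizer lam)).

Definition specht_repr d (lam : intpart d) :
    mx_representation algC [set: 'S_d] (\rank (specht_mx lam)) :=
  submod_repr (cyclic_mx_module (regular_repr algC [set: 'S_d])
                                (gring_row (young_symmetrizer lam))).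

(** * Cycle types *)

Lemma cycle_type_subproof d (g : 'S_d) :
  is_intpart d (sort geq [seq #|X| | X : {set 'I_d} <- enum (porbits g)]).
Proof.
apply/and3P; split.
- by apply: sort_sorted => x y; apply: leq_total.
- rewrite mem_sort; apply/mapP => -[X].
  by rewrite mem_enum => /imsetP[x _ ->] /esym/eqP; apply/negP/card_porbit_neq0.
rewrite sumnE (perm_big _ (permEl (perm_sort _ _))) big_map /= big_enum /=.
suff /card_partition <- : partition (porbits g) [set: 'I_d].
  by rewrite cardsT card_ord.
apply/and3P; split.
- rewrite eqEsubset subsetT; apply/subsetP => x _; apply/bigcupP.
  by exists (porbit g x); [apply: imset_f | apply: porbit_id].
- apply/trivIsetP => _ _ /imsetP[x _ ->] /imsetP[y _ ->].
  apply: contraR => /pred0Pn[z /andP[/= zx zy]].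
  rewrite -!eq_porbit_mem in zx zy.
  by rewrite -(eqP zx) -(eqP zy).
- apply/imsetP => -[x _ /esym eq0].
  by have := porbit_id g x; rewrite eq0 inE.
Qed.

Definition cycle_type d (g : 'S_d) : intpart d := IntPart (cycle_type_subproof g).

(** The common value of the trace of [rho] on the permutations of cycle type
    [alpha]. *)
Definition chi_at d n (rho : mx_representation algC [set: 'S_d] n)
    (alpha : intpart d) : algC :=
  if [pick g : 'S_d | cycle_type g == alpha] is Some g
  then cfRepr rho g else 0.

(** * The invariant o(rho) *)

Definition split_part (k : nat) : seq nat :=
  if odd k then [:: k] else [:: k./2; k./2].

Lemma sq_subproof d (beta : intpart d) :
  is_intpart d (sort geq (flatten [seq split_part k | k <- beta])).
Proof.
case: beta => s /= /and3P[_ s0 /eqP sum_s]; apply/and3P; split.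
- by apply: sort_sorted => x y; apply: leq_total.
- rewrite mem_sort; apply/flatten_mapP => -[k ks]; rewrite /split_part.
  have: k != 0%N by apply: contraNneq s0 => <-.
  by case: k {ks} => [|[|k]] // _; case: ifP => _; rewrite !inE.
rewrite sumnE (perm_big _ (permEl (perm_sort _ _))) -sumnE sumn_flatten -map_comp.
rewrite -sum_s; apply/eqP; congr (sumn _); rewrite -[RHS]map_id.
apply: eq_map => k /=; rewrite /split_part; case: ifP => /= [_|/negbT ev_k].
  by rewrite addn0.
by rewrite addn0 addnn even_halfK.
Qed.

Definition sq d (beta : intpart d) : intpart d := IntPart (sq_subproof beta).

Definition odd_intpart d (beta : intpart d) : bool := odd (d - size beta).

Definition zeta d (beta : intpart d) : nat :=
  (\prod_(1 <= k < d.+1) ((count_mem k beta)`! * k ^ count_mem k beta))%N.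

Definition o_inv d n (rho : mx_representation algC [set: 'S_d] n) : algC :=
  \sum_(beta : intpart d | odd_intpart beta)
    chi_at rho (sq beta) / (zeta beta)%:R.

(** [Num.truncn] only retypes [o_inv rho] as an exponent: it is meant to be used
    when this algebraic number is a natural number. *)
Definition eps d n (rho : mx_representation algC [set: 'S_d] n) : int :=
  (-1) ^+ Num.truncn (o_inv rho).

(* Main.v *)
(** The number [o(rho)] is [(1 - nu) / 2], where [nu] is the sign-twisted
    Frobenius-Schur indicator, i.e., the average of [sgn(g) chi(g^2)]; indeed the
    untwisted indicator is 1, as [rho] is real. By Schur's lemma [nu] is the
    symmetry sign of any nonzero bilinear form [B] on [rho] that satisfies
    [B (x g) (y g) = sgn(g) B x y].

    The Specht module is the right ideal [c C[S_d]] with [c = a b] the Young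
    symmetrizer. Let [t] be the permutation that transposes the boxes of the
    self-conjugate diagram; it is an involution that exchanges the row group and
    the column group. Then [B x y = \sum_h x (t h) y h sgn(h)] is such a form on
    the group algebra, with symmetry sign [sgn(t)]. It does not vanish on the
    ideal since [c c <> 0], which follows from a positivity argument. As [t] has
    one fixed point for each diagonal box, it is a product of [(d - r) / 2]
    transpositions.

    The sum over partitions becomes a sum over [S_d] because there are
    [d! / zeta(beta)] permutations of cycle type [beta]. The order of a
    centralizer is computed by fixing the cycles one after the other: the
    pointwise stabilizer of a union of cycles acts transitively on the points
    of the other cycles of a given length. *)
Require Import Defs.
From mathcomp Require Import all_boot all_order all_algebra.
From mathcomp Require Import all_fingroup all_field all_character.
From mathcomp Require Import zify.

Set Implicit Arguments.
Unset Strict Implicit.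
Unset Printing Implicit Defensive.

Import GroupScope GRing.Theory Num.Theory.

(** * Permutations of a given cycle type *)

Section Orbits.

Variable T : finType.
Implicit Types (g h p : {perm T}) (x y z : T) (S A B : {set T}).

(** Reduce [i] modulo the orbit size [n]: the first [n] iterates of [x] are distinct, so the
    remainder must vanish. *)
Lemma expg_fix_porbit g x i : ((g ^+ i) x == x) = (#|porbit g x| %| i).
Proof.
set n := #|porbit g x|.
have n_gt0 : 0 < n by rewrite lt0n card_porbit_neq0.
have gn j : (g ^+ (j * n)) x = x.
  rewrite mulnC expgM permX; elim: j => //= j ->.
  by rewrite permX iter_porbit.
rewrite /dvdn {1}(divn_eq i n) expgD permM gn.
set r := i %% n; have r_lt : r < n by rewrite ltn_mod.
have U := uniq_traject_porbit g x.
have := nth_uniq x (i := r) (j := 0) _ _ U; rewrite size_traject => /(_ r_lt n_gt0).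
by rewrite !nth_traject //= permX.
Qed.

Lemma expg_eq_porbit g x i j :
  ((g ^+ i) x == (g ^+ j) x) = (i == j %[mod #|porbit g x|]).
Proof.
wlog le_ji : i j / j <= i.
  move=> IH; case/orP: (leq_total j i) => /IH // H.
  by rewrite eq_sym H eq_sym.
rewrite eqn_mod_dvd // -expg_fix_porbit -{1}(subnK le_ji) expgD permM.
by rewrite (inj_eq perm_inj).
Qed.

Lemma eq_card_porbit g h x y :
  (forall i, ((g ^+ i) x == x) = ((h ^+ i) y == y)) ->
  #|porbit g x| = #|porbit h y|.
Proof.
move=> gh; apply/eqP; rewrite eqn_dvd -!expg_fix_porbit gh expg_fix_porbit dvdnn.
by rewrite -gh expg_fix_porbit dvdnn.
Qed.

(** Both sides have the same multiples [i]: the power [g ^+ (2 * i)] fixes [x] exactly when [n]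
    divides [2 * i]. *)
Lemma card_porbit_sqr g x : #|porbit (g ^+ 2) x| =
  if odd #|porbit g x| then #|porbit g x| else #|porbit g x|./2.
Proof.
set n := #|porbit g x|.
have sq_dvd i : (#|porbit (g ^+ 2) x| %| i) = (n %| 2 * i).
  by rewrite -!expg_fix_porbit expgM.
suff sq_dvd2 i : (#|porbit (g ^+ 2) x| %| i) = ((if odd n then n else n./2) %| i).
  by apply/eqP; rewrite eqn_dvd sq_dvd2 dvdnn -sq_dvd2 dvdnn.
rewrite sq_dvd; case: ifPn => [odd_n|ev_n]; first by rewrite Gauss_dvdr // coprimen2.
by rewrite -{1}[n]even_halfK // -muln2 mulnC dvdn_pmul2l.
Qed.

Lemma eq_porbit_stable g h S x : {in S, forall z, g z \in S} ->
  {in S, g =1 h} -> x \in S -> porbit g x = porbit h x.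
Proof.
move=> gS gh xS.
have it i : (g ^+ i) x \in S /\ (g ^+ i) x = (h ^+ i) x.
  elim: i => [|i [IHS IHi]]; first by rewrite !expg0 !perm1.
  by rewrite !expgSr !permM -IHi -gh // gS.
apply/setP => z; apply/porbitP/porbitP => -[i ->]; exists i; by case: (it i).
Qed.

Lemma porbit_stable g S x : {in S, forall z, g z \in S} -> x \in S ->
  porbit g x \subset S.
Proof.
move=> gS xS; apply/subsetP => _ /porbitP[i ->].
by elim: i => [|i IHi]; rewrite ?expg0 ?perm1 // expgSr permM gS.
Qed.

Lemma porbit_stableC g S x : {in S, forall z, g z \in S} -> x \notin S ->
  porbit g x \subset ~: S.
Proof.
move=> gS xS; apply/subsetP => z zx; rewrite inE; apply: contra xS => zS.
by apply: (subsetP (porbit_stable gS zS)); rewrite porbit_sym.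
Qed.

Lemma porbit_closed g x : {in porbit g x, forall z, g z \in porbit g x}.
Proof.
by move=> _ /porbitP[i ->]; rewrite -permM -expgSr mem_porbit.
Qed.

(** Counting points instead of cycles makes the count additive over subsets; on a [g]-stable set it
    is [k] times the number of [k]-cycles. *)
Definition cycle_pts g A k : {set T} := [set z in A | #|porbit g z| == k].

Lemma cycle_pts_porbit g x k :
  #|cycle_pts g (porbit g x) k| = if k == #|porbit g x| then k else 0.
Proof.
case: eqP => [->|ne_k].
  apply: eq_card => z; rewrite inE andb_idr // -eq_porbit_mem => /eqP ->.
  exact: eqxx.
apply/eqP; rewrite cards_eq0 -subset0; apply/subsetP => z; rewrite inE.
by rewrite -eq_porbit_mem => /andP[/eqP -> /eqP /esym].
Qed.

Lemma cycle_ptsD g A B k : B \subset A ->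
  #|cycle_pts g A k| = #|cycle_pts g B k| + #|cycle_pts g (A :\: B) k|.
Proof.
move=> BA; rewrite -(cardsID B (cycle_pts g A k)); congr (_ + _); apply: eq_card => z.
  rewrite !inE andbC andbA; congr (_ && _); rewrite andb_idr //; exact: (subsetP BA).
by rewrite !inE andbA.
Qed.

Lemma cycle_pts_gt0 g x A : x \in A -> 0 < #|cycle_pts g A #|porbit g x| |.
Proof. by move=> xA; apply/card_gt0P; exists x; rewrite inE xA /=. Qed.

(** On the [g]-stable set [S], the map [f] behaves like a permutation that
    conjugates [g] to [h]. *)
Definition partial_conj g h S (f : T -> T) :=
  [/\ {in S, forall z, g z \in S}, {in S &, injective f}
    & {in S, forall z, f (g z) = h (f z)}].

Lemma partial_conj_stable g h S f : partial_conj g h S f ->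
  {in f @: S, forall z, h z \in f @: S}.
Proof.
by case=> gS _ fgS _ /imsetP[z zS ->]; rewrite -fgS //; apply/imset_f/gS.
Qed.

(** Send [(g ^+ i) x] to [(h ^+ i) y]. Equal orbit lengths make this well defined and injective, and
    the new values avoid [f @: S] because that set is [h]-stable. *)
Lemma partial_conj_step g h S f x y :
    partial_conj g h S f -> x \notin S -> y \notin f @: S ->
    #|porbit g x| = #|porbit h y| ->
  exists f', [/\ partial_conj g h (S :|: porbit g x) f', {in S, f' =1 f},
    f' x = y & f' @: porbit g x = porbit h y].
Proof.
move=> pc; case: (pc) => gS f_inj fgS xS yS cxy; set n := #|porbit g x| in cxy.
(* On the orbit of [x], the index of [z] in the trajectory is an exponent [i] with
   [z = (g ^+ i) x]. *)
pose f' z := if z \in porbit g x then (h ^+ index z (traject g x n)) y else f z.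
have f'i i : f' ((g ^+ i) x) = (h ^+ i) y.
  rewrite /f' mem_porbit; apply/eqP; rewrite expg_eq_porbit -cxy.
  rewrite -expg_eq_porbit permX.
  set j := index _ _; have j_lt : j < n.
    by rewrite -[n in _ < n](size_traject g x) index_mem -porbit_traject mem_porbit.
  rewrite -[X in X == _](nth_traject g j_lt x) nth_index //.
  by rewrite -porbit_traject mem_porbit.
have f'S : {in S, f' =1 f}.
  move=> z zS; rewrite /f' ifN //; apply: contraL zS => zx.
  by have := subsetP (porbit_stableC gS xS) z zx; rewrite inE.
have imf : f' @: porbit g x = porbit h y.
  apply/setP => z; apply/imsetP/porbitP => [[_ /porbitP[i ->] ->]|[i ->]].
    by exists i.
  by exists ((g ^+ i) x); rewrite ?mem_porbit.
have fS_y z : z \in porbit h y -> z \notin f @: S.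
  move=> zy; have := subsetP (porbit_stableC (partial_conj_stable pc) yS) z zy.
  by rewrite inE.
exists f'; split=> //; last by have := f'i 0; rewrite !expg0 !perm1.
split.
- move=> z; rewrite !inE => /orP[/gS->//|zx].
  by rewrite porbit_closed // orbT.
- move=> z1 z2; rewrite !inE => /orP[z1S|z1x] /orP[z2S|z2x].
  + by rewrite !f'S //; apply: f_inj.
  + rewrite f'S // => eqf; have /fS_y : f' z2 \in porbit h y by rewrite -imf imset_f.
    by rewrite -eqf imset_f.
  + rewrite (f'S z2) // => eqf.
    have /fS_y : f' z1 \in porbit h y by rewrite -imf imset_f.
    by rewrite eqf imset_f.
  + case/porbitP: z1x => i ->; case/porbitP: z2x => j ->; rewrite !f'i => /eqP.
    by rewrite expg_eq_porbit -cxy -expg_eq_porbit => /eqP.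
- move=> z; rewrite !inE => /orP[zS|/porbitP[i ->]]; first by rewrite !f'S ?gS ?fgS.
  by rewrite -permM -expgSr !f'i expgSr permM.
Qed.

(** Induction on the size of the complement of [S]. Equality of the counts supplies, for any [x]
    outside [S], a [y] outside the image on a cycle of the same length, and it survives the removal
    of both cycles. *)
Lemma partial_conj_extend g h S f : partial_conj g h S f ->
    (forall k, #|cycle_pts g (~: S) k| = #|cycle_pts h (~: f @: S) k|) ->
  exists2 p : {perm T}, {in S, p =1 f} & forall z, p (g z) = h (p z).
Proof.
move: {2}_.+1 (ltnSn #|~: S|) => N; elim: N => // N IHN in S f *.
rewrite ltnS => leN pc cgh; have [S0|[x]] := set_0Vmem (~: S).
  have ST z : z \in S by have := in_set0 z; rewrite -S0 inE => /negbFE.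
  case: pc => _ f_inj fgS; have finj : injective f by move=> ? ? /f_inj->.
  by exists (perm finj) => [z _|z]; rewrite !permE ?fgS.
move=> xSc; have xS : x \notin S by rewrite inE in xSc.
have := cycle_pts_gt0 g xSc; rewrite cgh => /card_gt0P[y].
rewrite 2!inE => /andP[yS /eqP /esym cxy].
have [f' [pc' f'S _ f'x]] := partial_conj_step pc xS yS cxy.
have sx : porbit g x \subset ~: S by case: pc => gS _ _; apply: porbit_stableC.
have sy : porbit h y \subset ~: f @: S.
  exact/porbit_stableC/yS/partial_conj_stable/pc.
have [||p pf' pgh] := IHN _ _ _ pc'.
- rewrite setCU -setDE; apply: leq_trans leN; apply/proper_card/properP; split.
    exact: subsetDl.
  by exists x => //; rewrite inE porbit_id.
- move=> k; rewrite setCU -setDE imsetU f'x setCU -setDE.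
  rewrite (eq_in_imset f'S).
  have := cgh k; rewrite (cycle_ptsD g k sx) (cycle_ptsD h k sy).
  by rewrite !cycle_pts_porbit cxy => /addnI.
exists p => // z zS; by rewrite pf' ?f'S // inE zS.
Qed.

Lemma partial_conj0 g h f : partial_conj g h set0 f.
Proof. by split=> z; rewrite inE. Qed.

Lemma conjg_of_cycle_pts g h :
  (forall k, #|cycle_pts g setT k| = #|cycle_pts h setT k|) ->
  exists p : {perm T}, h = g ^ p.
Proof.
move=> cgh; have [|p _ pgh] := partial_conj_extend (partial_conj0 g h id).
  by move=> k; rewrite imset0 setC0.
exists p; apply/permP => z; rewrite conjgE !permM.
by rewrite pgh permKV.
Qed.

Lemma cycle_pts_conjg g p k : #|cycle_pts (g ^ p) setT k| = #|cycle_pts g setT k|.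
Proof.
rewrite -(card_imset (cycle_pts g setT k) (@perm_inj _ p)); apply: eq_card => z.
rewrite -[z](permKV p) (mem_imset _ _ (@perm_inj _ p)) !inE.
congr (_ == _); apply: eq_card_porbit => i.
by rewrite -conjXg conjgE !permM permK (inj_eq perm_inj).
Qed.

(** A stabilizer chain: the whole centralizer for empty [S], shrinking to the trivial group as
    cycles of [g] are added to [S]. *)
Definition cent_fixing g S : {group {perm T}} := ('C[g] :&: 'C(S | 'P))%G.

Lemma cent_fixingP g S p : reflect ((forall z, p (g z) = g (p z)) /\ {in S, p =1 id})
  (p \in cent_fixing g S).
Proof.
rewrite inE; apply: (iffP andP) => -[].
  by move/cent1P => pg /astabP pS; split => [z|z /pS //]; rewrite -!permM pg.
move=> pg pS; split; last by apply/astabP => z /pS.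
by apply/cent1P/permP => z; rewrite !permM pg.
Qed.

(** Commuting with [g] preserves cycle lengths. Conversely, the identity of [S] extends by [x |-> y]
    along the cycle of [x], and then to a permutation that commutes with [g]. *)
Lemma orbit_cent_fixing g S x : {in S, forall z, g z \in S} -> x \notin S ->
  orbit 'P (cent_fixing g S) x = cycle_pts g (~: S) #|porbit g x|.
Proof.
move=> gS xS; apply/setP => y; apply/orbitP/idP => [[p /cent_fixingP[pg pS] <-]|].
  rewrite !inE /=; apply/andP; split.
    by apply: contra xS => pxS; rewrite -(perm_inj (pS _ pxS)).
  apply/eqP/eq_card_porbit => i.
  have -> : (g ^+ i) (aperm x p) = p ((g ^+ i) x).
    elim: i => [|i IHi]; first by rewrite !expg0 !perm1.
    by rewrite !expgSr !permM IHi pg.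
  by rewrite (inj_eq perm_inj).
rewrite 2!inE => /andP[yS /eqP cyx].
have pc : partial_conj g g S id by split.
have yS' : y \notin id @: S by rewrite imset_id.
have [f' [pc' f'S f'x imf]] := partial_conj_step pc xS yS' (esym cyx).
have [|p pf' pg] := partial_conj_extend pc'.
  move=> k; rewrite imsetU (eq_in_imset f'S) imset_id imf !setCU -!setDE.
  have := cycle_ptsD g k (porbit_stableC gS yS).
  rewrite (cycle_ptsD g k (porbit_stableC gS xS)) !cycle_pts_porbit cyx.
  exact: addnI.
exists p; last by rewrite /= /aperm pf' ?f'x // inE porbit_id orbT.
by apply/cent_fixingP; split => // z zS; rewrite pf' ?f'S // inE zS.
Qed.

Lemma stab_cent_fixing g S x :
  'C_(cent_fixing g S)[x | 'P] = cent_fixing g (S :|: porbit g x).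
Proof.
apply/setP => p; rewrite in_setI; apply/andP/cent_fixingP.
  case=> /cent_fixingP[pg pS] /astab1P px; split => // z; rewrite inE => /orP[/pS//|].
  case/porbitP=> i ->; elim: i => [|i IHi]; first by rewrite expg0 perm1.
  by rewrite expgSr permM pg IHi.
case=> pg pS; split; last by apply/astab1P/pS; rewrite inE porbit_id orbT.
by apply/cent_fixingP; split => // z zS; apply: pS; rewrite inE zS.
Qed.

(** Orbit-stabilizer at a point [x] outside [S] on a cycle of length [K]: its orbit has [K * m K]
    points, and its stabilizer is the next group of the chain, with one [K]-cycle fewer outside the
    fixed set. *)
Lemma card_cent_fixing g S (m : nat -> nat) : {in S, forall z, g z \in S} ->
    (forall k, #|cycle_pts g (~: S) k| = (k * m k)%N) ->
  #|cent_fixing g S| = (\prod_(1 <= k < #|T|.+1) ((m k)`! * k ^ m k))%N.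
Proof.
move: {2}_.+1 (ltnSn #|~: S|) => N; elim: N => // N IHN in S m *.
rewrite ltnS => leN gS cm; have [S0|[x]] := set_0Vmem (~: S).
  (* The equation at [k = 0] leaves [m 0] free; the product starts at 1. *)
  have m0 k : 0 < k -> m k = 0.
    move=> k_gt0; have /esym/eqP := cm k; rewrite S0.
    rewrite (_ : cycle_pts g set0 k = set0) ?cards0 ?muln_eq0; last first.
      by apply/setP => z; rewrite !inE.
    by rewrite -[k == 0]negbK -lt0n k_gt0 => /eqP.
  rewrite big_nat big1 => [|k /andP[k_gt0 _]]; last by rewrite m0.
  apply/eqP/cards1P; exists 1; apply/setP => p; rewrite inE.
  apply/cent_fixingP/eqP => [[_ pS]|->]; last by split=> [z|z _]; rewrite !perm1.
  apply/permP => z; rewrite perm1 pS //.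
  by have := in_set0 z; rewrite -S0 inE => /negbFE.
move=> xSc; have xS : x \notin S by rewrite inE in xSc.
set K := #|porbit g x|.
have K_gt0 : 0 < K by rewrite lt0n card_porbit_neq0.
have K_le : K < #|T|.+1 by rewrite ltnS max_card.
have mK_gt0 : 0 < m K.
  by have := cycle_pts_gt0 g xSc; rewrite cm muln_gt0 => /andP[].
rewrite -(card_orbit_stab 'P _ x) orbit_cent_fixing // stab_cent_fixing cm -/K.
rewrite (IHN _ (fun k => if k == K then (m k).-1 else m k)).
- rewrite (bigD1_seq K) /= ?mem_index_iota ?iota_uniq ?K_gt0 //.
  rewrite [RHS](bigD1_seq K) /= ?mem_index_iota ?iota_uniq ?K_gt0 //.
  rewrite eqxx mulnA; congr (_ * _)%N; last by apply: eq_bigr => k /negPf ->.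
  by rewrite -{1 4 5}(prednK mK_gt0) factS expnS; lia.
- rewrite setCU -setDE; apply: leq_trans leN; apply/proper_card/properP; split.
    exact: subsetDl.
  by exists x => //; rewrite inE porbit_id.
- move=> z; rewrite !inE => /orP[/gS->//|zx].
  by rewrite porbit_closed // orbT.
- move=> k; rewrite setCU -setDE; have := cm k.
  rewrite (cycle_ptsD g k (porbit_stableC gS xS)) cycle_pts_porbit -/K.
  by case: eqP => [->|] //; rewrite -{1}(prednK mK_gt0) mulnS => /addnI.
Qed.

End Orbits.

(** * Permutations with prescribed cycle lengths *)

Lemma eq_intpart d (lam mu : intpart d) :
  (forall k, 0 < k -> count_mem k lam = count_mem k mu) -> lam = mu.
Proof.
move=> eq_c; apply: val_inj => /=.
case/and3P: (partsP lam) => slam lam0 _; case/and3P: (partsP mu) => smu mu0 _.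
apply: (sorted_eq (leT := geq)) => //.
- by move=> x y z xy yz; apply: leq_trans yz xy.
- by move=> x y; rewrite andbC -eqn_leq => /eqP.
apply/allP => -[|k] _ /=; last by apply/eqP/eq_c.
by rewrite !(count_memPn _).
Qed.

(** The cycle follows [next] along [enum X]; its inverse is [prev]. *)
Lemma cycle_exists (T : finType) (X : {set T}) :
  exists2 c : {perm T}, perm_on X c & {in X, forall z, porbit c z = X}.
Proof.
have Uq := enum_uniq X; exists (perm (can_inj (prev_next Uq))).
  apply/subsetP => z; rewrite inE permE next_nth mem_enum.
  by case: ifP => //; rewrite eqxx.
set c := perm _ => z zX; apply/setP => y.
have cc : fcycle c (enum X).
  rewrite (eq_cycle (e' := frel (next (enum X)))) ?cycle_next // => u v /=.
  by rewrite permE.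
rewrite -[RHS]mem_enum -(fconnect_cycle cc (x := z)) ?mem_enum //.
apply/porbitP/idP => [[i ->]|/iter_findex <-]; first by rewrite permX fconnect_iter.
by exists (findex c z y); rewrite permX.
Qed.

(** Induction on [s]: a cycle on [a] chosen points of [A], times a permutation of the remaining
    points given by the induction hypothesis. *)
Lemma cycle_pts_exists (T : finType) (s : seq nat) (A : {set T}) :
    0 \notin s -> #|A| = sumn s ->
  exists2 g : {perm T}, perm_on A g
    & forall k, #|cycle_pts g A k| = (k * count_mem k s)%N.
Proof.
elim: s A => [|a s IHs] A /=.
  move=> _ /eqP; rewrite cards_eq0 => /eqP ->; exists 1; first exact: perm_on1.
  move=> k; rewrite muln0; apply/eqP; rewrite cards_eq0 -subset0.
  by apply/subsetP => z; rewrite !inE.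
rewrite inE negb_or => /andP[a0 s0] cA.
pose X := [set z in take a (enum A)].
have XA : X \subset A.
  by apply/subsetP => z; rewrite inE => /mem_take; rewrite mem_enum.
have cX : #|X| = a.
  rewrite cardsE (card_uniqP _) ?take_uniq ?enum_uniq // size_takel //.
  by rewrite -cardE cA leq_addr.
have [||h hAX ch] := IHs (A :\: X) => //.
  by rewrite cardsD (setIidPr XA) cA cX addKn.
have [c cXX pc] := cycle_exists X.
(* The supports are disjoint, so orbits of the product are those of [c] on [X] and those of [h] on
   [A :\: X]. *)
have gX : {in X, c * h =1 c}.
  move=> z zX; rewrite permM (out_perm hAX) // inE negb_and negbK.
  by rewrite (perm_closed _ cXX) zX.
have gAX : {in A :\: X, c * h =1 h}.
  by move=> z; rewrite inE => /andP[zX _]; rewrite permM (out_perm cXX).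
exists (c * h).
  apply: perm_onM; first exact: subset_trans cXX XA.
  exact: subset_trans hAX (subsetDl _ _).
move=> k; rewrite (cycle_ptsD _ k XA) mulnDr -ch; congr addn.
  have [eq_ak|ne_ak] := eqVneq a k.
    rewrite muln1 -eq_ak -[RHS]cX; apply: eq_card => z; rewrite inE andb_idr // => zX.
    rewrite (eq_porbit_stable (S := X) _ gX) ?pc ?cX // => u uX.
    by rewrite gX // (perm_closed _ cXX).
  rewrite muln0; apply/eqP; rewrite cards_eq0 -subset0; apply/subsetP => z.
  rewrite inE => /andP[zX]; rewrite (eq_porbit_stable (S := X) _ gX) ?pc ?cX //.
    by rewrite (negPf ne_ak).
  by move=> u uX; rewrite gX // (perm_closed _ cXX).
apply: eq_card => z; rewrite !inE; case: (boolP (z \in A :\: X)) => zAX; last first.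
  by rewrite !inE in zAX; rewrite (negPf zAX).
rewrite (eq_porbit_stable (S := A :\: X) _ gAX) // => u uX.
by rewrite gAX // (perm_closed _ hAX).
Qed.

(** * Cycle types, their squares and the sizes of their classes *)

Section CycleType.

Variable d : nat.
Implicit Types (g h : 'S_d) (beta : intpart d).

(** Sort the points by the orbit that contains them. *)
Lemma card_cycle_pts g k :
  #|cycle_pts g setT k| = (k * count_mem k (cycle_type g))%N.
Proof.
rewrite (seq.permP (permEl (perm_sort _ _))) count_map -sum1_card.
rewrite (partition_big (porbit g)
           (fun X => (X \in porbits g) && (#|X| == k))) /=; last first.
  by move=> z; rewrite !inE /= => ->; rewrite imset_f.
rewrite -sum1_count big_enum_cond /= mulnC big_distrl /=.
apply: eq_bigr => X /andP[/imsetP[x _ ->] /eqP cx].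
rewrite mul1n -[RHS]cx -sum1_card; apply: eq_bigl => z.
rewrite !inE eq_porbit_mem andb_idl // -eq_porbit_mem => /eqP ->.
by rewrite cx eqxx.
Qed.

Lemma cycle_typeP g beta :
  reflect (forall k, #|cycle_pts g setT k| = (k * count_mem k beta)%N)
    (cycle_type g == beta).
Proof.
apply: (iffP eqP) => [<- k|cg]; first exact: card_cycle_pts.
apply: eq_intpart => k k_gt0; apply/eqP; rewrite -(eqn_pmul2l k_gt0).
by rewrite -card_cycle_pts cg.
Qed.

Lemma cycle_type_conjg g h : cycle_type g = cycle_type h ->
  exists p : 'S_d, h = g ^ p.
Proof.
by move=> gh; apply: conjg_of_cycle_pts => k; rewrite !card_cycle_pts gh.
Qed.

Lemma cycle_typeJ g p : cycle_type (g ^ p) = cycle_type g.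
Proof.
by apply/eqP/cycle_typeP => k; rewrite cycle_pts_conjg card_cycle_pts.
Qed.

(** Both sides satisfy the same count: a point lies on a [k]-cycle of [g ^+ 2] when its [g]-cycle
    has length [2 * k], or length [k] with [k] odd. *)
Lemma cycle_type_sqr g : cycle_type (g ^+ 2) = sq (cycle_type g).
Proof.
apply/eqP/cycle_typeP => k.
rewrite (seq.permP (permEl (perm_sort _ _))).
transitivity ((if odd k then #|cycle_pts g setT k| else 0)
              + #|cycle_pts g setT (2 * k)|)%N.
  have cE (X : {set 'I_d}) : #|X| = (\sum_z (z \in X))%N.
    by rewrite -sum1_card big_mkcond; apply: eq_bigr => z _; case: ifP.
  rewrite !cE.
  rewrite [X in (X + _)%N](_ : _ = \sum_z (odd k && (#|porbit g z| == k)))%N.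
    rewrite -big_split; apply: eq_bigr => z _; rewrite !inE /= card_porbit_sqr.
    have := card_porbit_neq0 g z; move: #|porbit g z| => n n0.
    have := odd_double_half n; have := odd_double_half k.
    rewrite -!muln2; case: (odd n); case: (odd k) => /= kE nE;
      do 3?[case: eqP => /= ?]; lia.
  case: odd; last by rewrite big1.
  by apply: eq_bigr => z _; rewrite !inE /=; case: eqP.
(* What remains concerns the list of parts only, and is checked part by part. *)
rewrite !card_cycle_pts; elim: (parts _) => [|a s IHs] /=.
  by rewrite !muln0 if_same.
rewrite count_cat !mulnDr -IHs /split_part.
move: (k * count_mem k s)%N (2 * k * count_mem (2 * k)%N s)%N => u v.
have := odd_double_half a; have := odd_double_half k; rewrite -!muln2.
case: (odd a); case: (odd k) => /= kE aE; do 3?[case: eqP => /= ?]; lia.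
Qed.

Lemma odd_cycle_type g : odd_intpart (cycle_type g) = odd_perm g.
Proof.
rewrite /odd_intpart oddB ?size_parts // /odd_perm card_ord; congr (_ (+) odd _).
by rewrite size_sort size_map -cardE.
Qed.

Lemma cycle_type_exists beta : exists g : 'S_d, cycle_type g = beta.
Proof.
case/and3P: (partsP beta) => _ b0 /eqP sb.
have [||g _ cg] := @cycle_pts_exists _ beta [set: 'I_d] => //.
  by rewrite cardsT card_ord sb.
by exists g; apply/eqP/cycle_typeP.
Qed.

(** The permutations of type [beta] form one conjugacy class, whose size is the index of a
    centralizer; [card_cent_fixing] with empty [S] gives the order [zeta beta] of the latter. *)
Lemma card_cycle_type beta :
  (#|[set g : 'S_d | cycle_type g == beta]| * zeta beta = d`!)%N.
Proof.
have [g <-] := cycle_type_exists beta.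
have -> : [set h : 'S_d | cycle_type h == cycle_type g] = g ^: setT.
  apply/setP => h; rewrite inE; apply/eqP/imsetP => [/esym/cycle_type_conjg|].
    by case=> p ->; exists p; rewrite ?inE.
  by case=> p _ ->; rewrite cycle_typeJ.
rewrite -index_cent1 mulnC -card_Sn -(cardsT 'S_d) -(LagrangeI setT 'C[g]).
congr (_ * _)%N; last by rewrite indexgI.
transitivity #|cent_fixing g set0|.
  rewrite (@card_cent_fixing _ _ _ (fun k => count_mem k (cycle_type g))).
  - by rewrite card_ord.
  - by move=> z; rewrite inE.
  - by move=> k; rewrite setC0 card_cycle_pts.
apply: eq_card => p; apply/cent_fixingP/setIP => [[pg _]|[_ /cent1P pg]].
  split; first by rewrite inE.
  by apply/cent1P/permP => z; rewrite !permM pg.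
by split=> z; [rewrite -!permM pg | rewrite inE].
Qed.

End CycleType.

Local Open Scope ring_scope.

(** * Twisted Frobenius-Schur indicators *)

(** The average commutes with [rG], hence is scalar by Schur's lemma over [algC]; the trace
    determines the scalar. *)
Lemma Schur_sum_repr (gT : finGroupType) (G : {group gT}) n
    (rG : mx_representation algC G n) (X : 'M_n) :
    mx_irreducible rG ->
  \sum_(g in G) rG g *m X *m rG g^-1%g = (#|G|%:R * \tr X / n%:R)%:M.
Proof.
move=> irrG; case/mx_irrP: (irrG) => n_gt0 _.
set M := LHS.
have cM : centgmx rG M.
  apply/centgmxP => h Gh; rewrite /M mulmx_suml mulmx_sumr.
  rewrite (reindex_inj (mulgI h)) /=; apply: eq_big => g; first by rewrite groupMl.
  move=> Gg; rewrite groupMl // in Gg.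
  by rewrite invMg !repr_mxM ?groupV // !mulmxA (repr_mxKV rG Gh).
have [a Ma] : exists a, M = a%:M.
  have := mx_abs_irr_cent_scalar (groupC irrG) cM.
  by move/is_scalar_mxP.
rewrite Ma; congr (_%:M).
have : \tr M = #|G|%:R * \tr X.
  rewrite /M raddf_sum /= (eq_bigr (fun=> \tr X)) ?sumr_const ?mulr_natl // => g Gg.
  by rewrite mxtrace_mulC mulmxA -repr_mxM ?groupV // mulVg repr_mx1 mul1mx.
rewrite Ma mxtrace_scalar => <-.
by rewrite -(mulr_natr a n) mulfK // pnatr_eq0 -lt0n.
Qed.

(** [J] is the Gram matrix of an [s]-invariant form, invertible since its kernel is a submodule.
    Invariance turns [s g * \tr (rG (g ^+ 2))] into the trace of
    [rG g *m J *m (rG g^-1)^T *m invmx J], and the sum over [g] becomes a Schur average. *)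
Lemma FS_indicator (gT : finGroupType) (G : {group gT}) n
    (rG : mx_representation algC G n) (s : gT -> algC) (J : 'M_n) (delta : algC) :
    mx_irreducible rG -> (forall g, s g ^+ 2 = 1) ->
    {in G, forall g, rG g *m J *m (rG g)^T = s g *: J} ->
    J != 0 -> J^T = delta *: J ->
  \sum_(g in G) s g * \tr (rG (g ^+ 2)%g) = delta * #|G|%:R.
Proof.
move=> irrG s2 JG J0 JT; case/mx_irrP: (irrG) => n_gt0 irr.
have rJ g : g \in G -> s g *: (rG g *m J) = J *m (rG g^-1%g)^T.
  move=> Gg; have := congr1 (mulmxr (rG g^-1%g)^T) (JG g Gg) => /=.
  rewrite -mulmxA -trmx_mul -repr_mxM ?groupV // mulVg repr_mx1 trmx1 mulmx1 => ->.
  by rewrite -scalemxAl scalerA -expr2 s2 scale1r.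
have uJ : J \in unitmx.
  rewrite -row_free_unit -kermx_eq0; apply/idPn => kJ.
  have mJ : mxmodule rG (kermx J).
    apply/mxmoduleP => g Gg; apply/sub_kermxP.
    rewrite -mulmxA -[rG g *m J]scale1r -(s2 g) expr2 -scalerA rJ // -scalemxAr.
    by rewrite mulmxA mulmx_ker mul0mx scaler0.
  have := irr _ mJ kJ; rewrite -sub1mx => /sub_kermxP.
  by rewrite mul1mx => /eqP; apply/negP.
have n0 : n%:R != 0 :> algC by rewrite pnatr_eq0 -lt0n.
(* Entry by entry, the sum is a combination of Schur averages of elementary matrices [delta_mx j l];
   only [j = l] and [k = i] survive, which picks the entry [J l i]. *)
have sumJ : \sum_(g in G) rG g *m J *m (rG g^-1%g)^T = (#|G|%:R / n%:R) *: J^T.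
  apply/matrixP => i l; rewrite summxE !mxE.
  transitivity (\sum_j \sum_k J j k *
     (\sum_(g in G) rG g *m delta_mx j l *m rG g^-1%g) i k).
    under eq_bigr => g _.
      rewrite mxE; under eq_bigr do rewrite !mxE mulr_suml.
      rewrite exchange_big; over.
    rewrite /= exchange_big; apply: eq_bigr => j _.
    rewrite exchange_big; apply: eq_bigr => k _.
    rewrite summxE mulr_sumr; apply: eq_bigr => g _.
    rewrite -mulmxA mxE (bigD1 j) //= big1 ?addr0; last first.
      move=> m mj; rewrite mxE big1 ?mulr0 // => m' _.
      by rewrite mxE (negPf mj) mul0r.
    rewrite mxE (bigD1 l) //= big1 ?addr0; last first.
      by move=> m mj; rewrite mxE (negPf mj) andbF mul0r.
    by rewrite !mxE !eqxx mul1r mulrCA mulrA.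
  have tr_delta j : \tr (delta_mx j l : 'M[algC]_n) = (j == l)%:R.
    rewrite /mxtrace (bigD1 j) //= big1 ?addr0 ?mxE ?eqxx // => m mj.
    by rewrite mxE (negPf mj).
  under eq_bigr => j _.
    under eq_bigr do rewrite Schur_sum_repr // tr_delta mxE.
    rewrite (bigD1 i) //= big1 ?addr0 => [|k ki]; last first.
      by rewrite [i == k]eq_sym (negPf ki) mulr0n mulr0.
    rewrite eqxx mulr1n; over.
  rewrite (bigD1 l) //= big1 ?addr0 => [|j jl].
    by rewrite eqxx mulr1 mulrC.
  by rewrite (negPf jl) mulr0 mul0r mulr0.
transitivity (\tr (\sum_(g in G) rG g *m J *m (rG g^-1%g)^T *m invmx J)).
  rewrite raddf_sum; apply: eq_bigr => g Gg /=.
  rewrite -[rG g *m J *m _]mulmxA -rJ // -scalemxAr -scalemxAl linearZ /=.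
  by rewrite -!mulmxA mulmxV // mulmx1 -repr_mxM.
rewrite -mulmx_suml sumJ JT scalerA -scalemxAl mulmxV // mxtraceZ mxtrace1.
by rewrite mulrAC mulfVK // mulrC.
Qed.

(** Restrict the form [F] to [U]; the vectors [x] and [y] witness that the restriction is
    nonzero. *)
Lemma FS_indicator_submod (gT : finGroupType) (G : {group gT}) n
    (rG : mx_representation algC G n) (U : 'M_n) (mU : mxmodule rG U)
    (s : gT -> algC) (F : 'M_n) (delta : algC) (x y : 'rV_n) :
    mx_irreducible (submod_repr mU) -> (forall g, s g ^+ 2 = 1) ->
    {in G, forall g, rG g *m F *m (rG g)^T = s g *: F} -> F^T = delta *: F ->
    (x <= U)%MS -> (y <= U)%MS -> x *m F *m y^T != 0 ->
  \sum_(g in G) s g * \tr (submod_repr mU (g ^+ 2)%g) = delta * #|G|%:R.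
Proof.
move=> irrU s2 FG FT xU yU xFy.
(* The rows of [W] are a basis of [U], so the restricted form has Gram matrix [W *m F *m W^T]. *)
have [W WE] : exists W, forall m (v : 'M_(m, \rank U)), val_submod v = v *m W.
  by exists (val_submod 1%:M) => m v; exact: val_submodE.
apply: (@FS_indicator _ _ _ (submod_repr mU) s (W *m F *m W^T)) => //.
- move=> g Gg; have WJ : submod_repr mU g *m W = W *m rG g.
    by have := val_submodJ mU 1%:M Gg; rewrite mul1mx !WE mul1mx.
  rewrite !mulmxA WJ -[LHS]mulmxA -trmx_mul WJ trmx_mul.
  rewrite mulmxA -(mulmxA W (rG g)) -(mulmxA W (rG g *m F)) FG //.
  by rewrite -scalemxAr -scalemxAl.
- apply: contraNneq xFy => W0.
  rewrite -(in_submodK xU) -(in_submodK yU) !WE trmx_mul; apply/eqP.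
  transitivity (in_submod U x *m (W *m F *m W^T) *m (in_submod U y)^T).
    by rewrite !mulmxA.
  by rewrite W0 mulmx0 mul0mx.
- by rewrite !trmx_mul trmxK FT mulmxA -scalemxAr -scalemxAl.
Qed.

(** The trace is the sum of the squares of the real entries. *)
Lemma trmx_mul_eq0 m n (M : 'M[algC]_(m, n)) :
  M \is a mxOver Num.real -> \tr (M *m M^T) = 0 -> M = 0.
Proof.
move=> /mxOverP rM trM; apply/matrixP => i j; rewrite !mxE.
have sq_ge0 k l : 0 <= M k l * M k l by rewrite -expr2 real_exprn_even_ge0.
have tE : \sum_k \sum_l M k l * M k l = 0.
  rewrite -[RHS]trM; apply: eq_bigr => k _; rewrite mxE.
  by apply: eq_bigr => l _; rewrite mxE.
have := tE; move/eqP; rewrite psumr_eq0 => [|k _]; last exact: sumr_ge0.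
move/allP/(_ i); rewrite mem_index_enum => /(_ isT) /=.
rewrite psumr_eq0 // => /allP/(_ j); rewrite mem_index_enum => /(_ isT) /=.
by rewrite mulf_eq0 orbb => /eqP.
Qed.

(** * Translations, sign twist and weighted sums in the group algebra *)

Section RegularRepresentation.

Variables (gT : finGroupType) (s : gT -> algC).
Hypotheses (sM : forall g h, s (g * h)%g = s g * s h)
           (s2 : forall g, s g ^+ 2 = 1).

Local Notation G := [set: gT].
Local Notation aG := (regular_repr algC G).
Local Notation w := (@enum_val gT (mem G)).
Local Notation idx := (gring_index G).
Local Notation MG := 'M[algC]_#|G|.
Local Notation e := (delta_mx 0 (idx 1%g) : 'rV[algC]_#|G|).

Implicit Types (M : MG) (g h t : gT) (H : {group gT}).

(** Translation on the side opposite to [aG], hence commuting with it: on row vectors, the basis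
    vector of [g] goes to that of [t^-1 * g]. *)
Definition lreg_mx t : MG := \matrix_(i, j) (w i == t * w j)%g%:R.
Definition twist_mx : MG := diag_mx (\row_i s (w i)).
Definition twisted_sum (u : gT -> algC) (H : {set gT}) : MG :=
  \sum_(g in H) u g *: aG g.

Lemma idxK g : w (idx g) = g.
Proof. by rewrite gring_indexK ?inE. Qed.

Lemma eq_idx i g : (i == idx g) = (w i == g).
Proof. by rewrite -(inj_eq enum_val_inj) idxK. Qed.

Lemma reg_mulmxE m g (M : 'M_(#|G|, m)) i j : (aG g *m M) i j = M (idx (w i * g)%g) j.
Proof.
rewrite mxE (bigD1 (idx (w i * g)%g)) //= big1 ?addr0 => [|k ne_k].
  by rewrite !mxE !eqxx mul1r.
by rewrite !mxE eqxx (negPf ne_k) mul0r.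
Qed.

Lemma lreg_mulmxE m t (M : 'M_(#|G|, m)) i j :
  (lreg_mx t *m M) i j = M (idx (t^-1 * w i)%g) j.
Proof.
rewrite mxE (bigD1 (idx (t^-1 * w i)%g)) //= big1 ?addr0 => [|k].
  by rewrite !mxE idxK mulKVg eqxx mul1r.
rewrite !mxE eq_idx => ne_k.
rewrite [_ == _](_ : _ = false) ?mul0r //; apply: contraNF ne_k => /eqP ->.
by rewrite mulKg.
Qed.

Lemma mulmx_lregE t M i j : (M *m lreg_mx t) i j = M i (idx (t * w j)%g).
Proof.
rewrite mxE (bigD1 (idx (t * w j)%g)) //= big1 ?addr0 => [|k].
  by rewrite !mxE idxK eqxx mulr1.
by rewrite !mxE eq_idx => /negPf ->; rewrite mulr0.
Qed.

Lemma lreg_comm t g : comm_mx (lreg_mx t) (aG g).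
Proof.
apply/matrixP => i j; rewrite lreg_mulmxE reg_mulmxE !mxE eqxx !idxK /=.
by rewrite eq_idx -(inj_eq (mulgI t)) -mulgA mulKVg eq_sym.
Qed.

Lemma tr_reg g : (aG g)^T = aG g^-1%g.
Proof.
apply/matrixP => i j; rewrite !mxE eqxx /= !eq_idx.
by rewrite -(inj_eq (mulIg g^-1%g)) mulgK eq_sym.
Qed.

Lemma tr_lreg t : (lreg_mx t)^T = lreg_mx t^-1%g.
Proof.
apply/matrixP => i j; rewrite !mxE.
by rewrite -(inj_eq (mulgI t^-1%g)) mulKg eq_sym.
Qed.

Lemma twist1 : s 1%g = 1.
Proof. by have := s2 1%g; rewrite expr2 -sM mulg1. Qed.

Lemma twistV g : s g^-1%g = s g.
Proof.
by rewrite -[RHS]mulr1 -twist1 -(mulgV g) sM mulrA -expr2 s2 mul1r.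
Qed.

Lemma twist_reg g : twist_mx *m aG g *m twist_mx = s g *: aG g.
Proof.
apply/matrixP => i j; rewrite mul_mx_diag mul_diag_mx !mxE eqxx /= eq_idx.
case: eqP => [->|_]; last by rewrite !(mulr0, mul0r).
by rewrite sM !mulr1 mulrA -expr2 s2 mul1r.
Qed.

Lemma twistK : twist_mx *m twist_mx = 1%:M.
Proof.
apply/matrixP => i j; rewrite mul_diag_mx !mxE.
by case: eqP => [->|_]; rewrite ?mulr0n ?mulr0 // !mulr1n -expr2 s2.
Qed.

Lemma twist_regC g : twist_mx *m aG g = s g *: (aG g *m twist_mx).
Proof. by rewrite scalemxAl -twist_reg -(mulmxA _ twist_mx) twistK mulmx1. Qed.

Lemma tr_twist : twist_mx^T = twist_mx.
Proof. exact: tr_diag_mx. Qed.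

Lemma twist_lreg t : twist_mx *m lreg_mx t = s t *: (lreg_mx t *m twist_mx).
Proof.
apply/matrixP => i j; rewrite mul_mx_diag mul_diag_mx !mxE.
by case: eqP => [->|_]; rewrite ?(mulr0, mul0r) // sM mulr1 mul1r.
Qed.

Lemma twisted_sum_tr (u : gT -> algC) H : (forall g, u g^-1%g = u g) ->
  (twisted_sum u H)^T = twisted_sum u H.
Proof.
move=> uV; rewrite linear_sum /twisted_sum (reindex_inj invg_inj) /=.
apply: eq_big => [g|g _]; first by rewrite groupV.
by rewrite linearZ /= uV tr_reg invgK.
Qed.

Lemma twisted_sum_idem (u : gT -> algC) H :
    (forall g h, u (g * h)%g = u g * u h) -> (forall g, u g ^+ 2 = 1) ->
  twisted_sum u H *m twisted_sum u H = #|H|%:R *: twisted_sum u H.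
Proof.
move=> uM u2; rewrite [X in X *m _]/twisted_sum mulmx_suml.
rewrite (eq_bigr (fun=> twisted_sum u H)) ?sumr_const ?scaler_nat // => g Hg.
rewrite mulmx_sumr [RHS](reindex_inj (mulgI g)) /=.
apply: eq_big => [h|h _]; first by rewrite groupMl.
by rewrite uM -scalemxAl -scalemxAr scalerA -repr_mxM ?inE.
Qed.

Lemma twisted_sum_real (u : gT -> algC) (X : {set gT}) :
  (forall g, u g ^+ 2 = 1) -> twisted_sum u X \is a mxOver Num.real.
Proof.
move=> u2; apply/mxOverP => i j; rewrite summxE; apply: rpred_sum => g _.
rewrite !mxE; apply: rpredM; last exact: realn.
by have /eqP := u2 g; rewrite sqrf_eq1 => /orP[]/eqP ->; rewrite ?rpredN rpred1.
Qed.

Lemma lreg_comm_sum t (u : gT -> algC) (X : {set gT}) :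
  comm_mx (lreg_mx t) (twisted_sum u X).
Proof.
apply: comm_mx_sum => g _.
by rewrite /comm_mx -scalemxAl -scalemxAr lreg_comm.
Qed.

(** Commuting with [lreg_mx (w i)] carries the diagonal entry at the identity to the one at [i], so
    the diagonal is constant. *)
Lemma tr_lreg_comm M : (forall t, comm_mx (lreg_mx t) M) ->
  \tr M = #|G|%:R * M (idx 1%g) (idx 1%g).
Proof.
move=> LM; rewrite /mxtrace (eq_bigr (fun=> M (idx 1%g) (idx 1%g))).
  by rewrite sumr_const card_ord mulr_natl.
move=> i _; have := congr1 (fun X : MG => X i (idx 1%g)) (LM (w i)).
by rewrite lreg_mulmxE mulmx_lregE idxK mulg1 mulVg gring_valK => ->.
Qed.


Lemma conj_twisted_sum (u : gT -> algC) t (X Y : {set gT}) :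
    (t * t = 1)%g -> (forall g, u (t * g * t)%g = u g) ->
    (forall g, (t * g * t \in Y)%g = (g \in X)) ->
  aG t *m twisted_sum u X *m aG t = twisted_sum u Y.
Proof.
move=> tt ut XY; rewrite mulmx_sumr mulmx_suml.
have inv_t : involutive (fun g => t * g * t)%g.
  by move=> g; rewrite -!mulgA tt mulg1 !mulgA tt mul1g.
rewrite [RHS](reindex_inj (inv_inj inv_t)) /=.
apply: eq_big => [g|g _]; first by rewrite XY.
by rewrite ut -scalemxAr -scalemxAl !repr_mxM ?inE.
Qed.

(** * Symmetrizers of two subgroups exchanged by an involution *)

Section Symmetrizer.

Variables (R C : {group gT}) (t : gT).
Hypotheses (tt : (t * t = 1)%g)
           (tRC : forall g, (t * g * t \in C)%g = (g \in R)).

Let A := twisted_sum (fun=> 1) R.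
Let B := twisted_sum s C.
Let c := A *m B.

Let AA : A *m A = #|R|%:R *: A.
Proof. by apply: twisted_sum_idem => *; rewrite ?mulr1 ?expr1n. Qed.
Let BB : B *m B = #|C|%:R *: B.
Proof. exact: twisted_sum_idem. Qed.
Let trA : A^T = A. Proof. exact: twisted_sum_tr. Qed.
Let trB : B^T = B. Proof. exact/twisted_sum_tr/twistV. Qed.

Lemma symmetrizer_real : c \is a mxOver Num.real.
Proof.
by apply: mxOverM; apply: twisted_sum_real => // *; rewrite expr1n.
Qed.

(** Up to nonzero factors, [\tr (c c)] is the squared norm of the real matrix
    [A B A], and [c c^T] is a multiple of [A B A]. *)
Lemma symmetrizer_sqr_neq0 : c != 0 -> (c *m c) (idx 1%g) (idx 1%g) != 0.
Proof.
apply: contraNneq => cc0.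
have trABAB : \tr (c *m c) = 0.
  rewrite tr_lreg_comm ?cc0 ?mulr0 // => h.
  by do 2!apply: comm_mxM; apply: lreg_comm_sum.
have ABA0 : A *m B *m A = 0.
  apply: trmx_mul_eq0.
    by apply: mxOverM symmetrizer_real _; apply: twisted_sum_real => *; rewrite expr1n.
  rewrite !trmx_mul trA trB !mulmxA -(mulmxA (A *m B)) AA -scalemxAr.
  rewrite -!scalemxAl linearZ /= mxtrace_mulC !mulmxA AA -!scalemxAl linearZ /=.
  by rewrite -!mulmxA (mulmxA A B) trABAB !mulr0.
apply/eqP/trmx_mul_eq0; first exact: symmetrizer_real.
rewrite trmx_mul trA trB !mulmxA -(mulmxA A) BB -scalemxAr -scalemxAl ABA0.
by rewrite scaler0 mxtrace0.
Qed.

Let tV : t^-1%g = t.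
Proof. by apply/eqP; rewrite eq_invg_mul tt. Qed.

Let c' : 'rV_#|G| := gring_row c.

Let st g : s (t * g * t)%g = s g.
Proof. by rewrite !sM mulrAC -expr2 s2 mul1r. Qed.

Let tCR g : (t * g * t \in R)%g = (g \in C).
Proof. by rewrite -tRC -!mulgA tt mulg1 !mulgA tt mul1g. Qed.

(** The bilinear form [(x, y) |-> \sum_h x (t h) y h s(h)] of the group algebra
    takes, on the pair [c t, c], the coefficient of [1] in [c c] as its value. *)
Lemma symmetrizer_form :
  c' *m aG t *m (lreg_mx t *m twist_mx) *m c'^T = e *m (c *m c) *m e^T.
Proof.
have c'E : c' = e *m c by rewrite -rowE.
(* At the basis vector of the identity, the twist is trivial and left and right translation by the
   involution [t] agree. *)
have De : twist_mx *m e^T = e^T.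
  apply/matrixP => i j; rewrite mul_diag_mx !mxE [j]ord1 eqxx eq_idx /=.
  by case: eqP => [->|_]; rewrite ?mulr0 // twist1 mul1r.
have Le : lreg_mx t *m e^T = aG t *m e^T.
  apply/matrixP => i j; rewrite lreg_mulmxE reg_mulmxE !mxE !eq_idx !idxK tV.
  by rewrite [j]ord1 eqxx /= -eq_invg_mul eq_sym eq_mulgV1 invgK.
set Bu := twisted_sum (fun=> 1) C; set As := twisted_sum s R.
(* Moving the twist across a sum exchanges the trivial weight and [s]: the column sum loses its
   signs and the row sum acquires them. *)
have DB : twist_mx *m B = Bu *m twist_mx.
  rewrite mulmx_sumr mulmx_suml; apply: eq_bigr => g _.
  by rewrite -scalemxAr twist_regC scalerA -expr2 s2 !scale1r.
have DA : twist_mx *m A = As *m twist_mx.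
  rewrite mulmx_sumr mulmx_suml; apply: eq_bigr => g _.
  by rewrite scale1r twist_regC scalemxAl.
rewrite c'E !trmx_mul trA trB -!mulmxA; congr (_ *m _).
rewrite (mulmxA twist_mx) DB -(mulmxA Bu) (mulmxA twist_mx A) DA -mulmxA De.
rewrite (mulmxA (lreg_mx t)) lreg_comm_sum -(mulmxA Bu) (mulmxA (lreg_mx t)).
rewrite lreg_comm_sum -(mulmxA As) Le.
(* Inserting [t * t = 1] in the middle exposes two conjugates by [t]: that of [Bu] is [A] and that
   of [As] is [B], whence [c *m c]. *)
have -> : A *m (B *m (aG t *m (Bu *m (As *m (aG t *m e^T))))) =
          A *m B *m (aG t *m Bu *m aG t) *m (aG t *m As *m aG t) *m e^T.
  by rewrite !mulmxA -(mulmxA _ (aG t) (aG t)) -repr_mxM ?inE // tt repr_mx1 mulmx1.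
rewrite (conj_twisted_sum (Y := R)) // (conj_twisted_sum (Y := C)) //.
by rewrite !mulmxA.
Qed.

(** The first sum uses the form of [symmetrizer_form], of symmetry sign [s t] and nonzero on the
    pair [c' *m aG t], [c']. The second uses the standard dot product, nonzero on [c'] paired with
    itself because [c'] is real and nonzero. *)
Lemma FS_symmetrizer :
    mx_irreducible (submod_repr (cyclic_mx_module aG c')) ->
  let rho := submod_repr (cyclic_mx_module aG c') in
  \sum_(g : gT) s g * \tr (rho (g ^+ 2)%g) = s t * #|G|%:R
  /\ \sum_(g : gT) \tr (rho (g ^+ 2)%g) = #|G|%:R.
Proof.
move=> irr rho.
have c'0 : c' != 0.
  apply/eqP => c'_eq0; case/mx_irrP: irr => + _.
  by rewrite lt0n mxrank_eq0 cyclic_mx_eq0 c'_eq0 eqxx.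
have c0 : c != 0 by apply: contraNneq c'0 => c_eq0; rewrite /c' c_eq0 linear0.
split.
  transitivity (\sum_(g in G) s g * \tr (rho (g ^+ 2)%g)).
    by apply: eq_bigl => g; rewrite inE.
  apply: (@FS_indicator_submod _ _ _ _ _ _ s (lreg_mx t *m twist_mx) (s t)
            (c' *m aG t) c') => //.
  - move=> g _; rewrite mulmxA -lreg_comm tr_reg -!mulmxA twist_regC twistV.
    rewrite -!scalemxAr (mulmxA (aG g)) -repr_mxM ?inE // mulgV repr_mx1.
    by rewrite mul1mx.
  - by rewrite trmx_mul tr_twist tr_lreg tV twist_lreg.
  - have /mxmoduleP/(_ t (in_setT t)) := cyclic_mx_module aG c'.
    exact/submx_trans/submxMr/cyclic_mx_id.
  - exact: cyclic_mx_id.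
  - rewrite symmetrizer_form.
    apply: contraNneq (symmetrizer_sqr_neq0 c0) => /(congr1 (fun X : 'M_1 => X 0 0)).
    by rewrite -rowE trmx_delta -colE 2!mxE [RHS]mxE => <-.
rewrite -[RHS]mul1r.
transitivity (\sum_(g in G) 1 * \tr (rho (g ^+ 2)%g)).
  by apply: eq_big => [g|g _]; rewrite ?inE ?mul1r.
apply: (@FS_indicator_submod _ _ _ _ _ _ (fun=> 1) 1%:M 1 c' c') => //.
- by move=> _; rewrite expr1n.
- by move=> g _; rewrite mulmx1 tr_reg -repr_mxM ?inE // mulgV repr_mx1 scale1r.
- by rewrite trmx1 scale1r.
- exact: cyclic_mx_id.
- exact: cyclic_mx_id.
- rewrite mulmx1; apply: contraNneq c'0 => cc0; apply/eqP/trmx_mul_eq0.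
    by apply/mxOverP => i j; rewrite mxE; apply/(mxOverP symmetrizer_real).
  by rewrite cc0 mxtrace0.
Qed.

End Symmetrizer.

End RegularRepresentation.

(** * Self-conjugate Specht modules *)

(** The permutation picked by [chi_at] is conjugate to [g]. *)
Lemma chi_at_cycle_type d n (rho : mx_representation algC [set: 'S_d] n) g :
  chi_at rho (cycle_type g) = cfRepr rho g.
Proof.
rewrite /chi_at; case: pickP => [h /eqP/cycle_type_conjg[p ->]|/(_ g)].
  by rewrite cfunJ ?inE.
by rewrite eqxx.
Qed.

(** Group the permutations by cycle type: type [beta] occurs [d! / zeta beta] times, and there
    [g ^+ 2] has type [sq beta]. *)
Lemma o_invE d n (rho : mx_representation algC [set: 'S_d] n) :
  o_inv rho = (\sum_(g : 'S_d | odd_perm g) cfRepr rho (g ^+ 2)%g) / d`!%:R.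
Proof.
rewrite (partition_big (@cycle_type d) (@odd_intpart d)) /= => [|g]; last first.
  by rewrite odd_cycle_type.
rewrite mulr_suml; apply: eq_bigr => beta odd_b.
rewrite (eq_bigr (fun=> chi_at rho (sq beta))) => [|g /andP[_ /eqP <-]]; last first.
  by rewrite -cycle_type_sqr chi_at_cycle_type.
rewrite (eq_bigl (mem [set g : 'S_d | cycle_type g == beta])) => [|g]; last first.
  rewrite !inE; apply: andb_idl => /eqP g_b.
  by rewrite -odd_cycle_type g_b.
rewrite sumr_const -(card_cycle_type beta) natrM -(mulr_natl (chi_at _ _)).
set N := #|_|; have N0 : N%:R != 0 :> algC.
  have := fact_gt0 d; rewrite -(card_cycle_type beta) muln_gt0 => /andP[N_gt0 _].
  by rewrite pnatr_eq0 -lt0n.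
by rewrite invfM mulrACA mulfV // mul1r.
Qed.

(** * The permutation transposing the boxes of a self-conjugate diagram *)

Section Transposition.

Variables (d : nat) (lam : intpart d).
Hypothesis lam_sc : self_conjugate lam.

Local Notation row := (tableau_row lam).
Local Notation col := (tableau_col lam).

Let sumn_lam : sumn lam = d.
Proof. by case/and3P: (partsP lam) => _ _ /eqP. Qed.

Lemma in_diagram_tableau k : in_diagram lam (row k) (col k).
Proof. by apply: reshape_offsetP; rewrite sumn_lam. Qed.

Lemma tableauK k : flatten_index lam (row k) (col k) = k.
Proof. exact: reshape_indexK. Qed.

Lemma tableau_box i j : in_diagram lam i j -> exists k, row k = i /\ col k = j.
Proof.
move=> ij; have lt_d : (flatten_index lam i j < d)%N.
  by rewrite -[X in (_ < X)%N]sumn_lam flatten_indexP.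
by exists (Ordinal lt_d); rewrite /tableau_row /tableau_col
  flatten_indexKl ?flatten_indexKr.
Qed.

Lemma tableau_inj k k' : row k = row k' -> col k = col k' -> k = k'.
Proof. by move=> r c; apply: val_inj; rewrite /= -tableauK r c tableauK. Qed.

Lemma transpose_box :
  exists t : 'S_d, forall k, row (t k) = col k /\ col (t k) = row k.
Proof.
have ex k : [exists k', (row k' == col k) && (col k' == row k)].
  have := in_diagram_tableau k; rewrite lam_sc => /tableau_box[k' [<- <-]].
  by apply/existsP; exists k'; rewrite !eqxx.
pose f k := xchoose (existsP (ex k)).
have fP k : row (f k) = col k /\ col (f k) = row k.
  by have /andP[/eqP-> /eqP->] := xchooseP (existsP (ex k)).
have fK : involutive f.
  move=> k; have [r c] := fP (f k); have [r' c'] := fP k.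
  by apply: tableau_inj; congruence.
by exists (perm (inv_inj fK)) => k; rewrite permE.
Qed.

Variable t : 'S_d.
Hypothesis tP : forall k, row (t k) = col k /\ col (t k) = row k.

Lemma transposeK : (t * t = 1)%g.
Proof.
apply/permP => k; rewrite permM perm1; apply: tableau_inj.
  by rewrite (tP _).1 (tP _).2.
by rewrite (tP _).2 (tP _).1.
Qed.

Lemma transpose_row_group g :
  (t * g * t \in col_group lam)%g = (g \in row_group lam).
Proof.
rewrite !inE; apply/forallP/forallP => tg k; last first.
  by rewrite !permM (tP _).2 -(tP k).1; apply: tg.
have := tg (t k); rewrite !permM (tP _).2 (tP _).2.
by rewrite -[t (t k)]permM transposeK perm1.
Qed.

(** The fixed points are the diagonal boxes, and a diagonal box is determined by its row. *)
Lemma card_fix_transpose : #|cycle_pts t setT 1%N| = diag_length lam.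
Proof.
pose F := [set k | row k == col k].
have -> : cycle_pts t setT 1%N = F.
  apply/setP => k; rewrite !inE -dvdn1 -expg_fix_porbit expg1.
  apply/eqP/eqP => [tk|rc]; first by rewrite -{1}tk (tP k).1.
  by apply: tableau_inj; [rewrite (tP k).1|rewrite (tP k).2].
rewrite cardE -(size_map row) /diag_length -size_filter; apply/perm_size/uniq_perm.
- rewrite map_inj_in_uniq ?enum_uniq // => k k'; rewrite !mem_enum !inE.
  by move=> /eqP rc /eqP rc' r; apply: tableau_inj; rewrite // -rc -rc'.
- by rewrite filter_uniq ?iota_uniq.
move=> i; rewrite mem_filter mem_iota; apply/mapP/and3P => [[k]|[ii _ _]].
  rewrite mem_enum inE => /eqP rc ->; split=> //.
    by have := in_diagram_tableau k; rewrite -rc.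
  by apply: reshape_indexP; rewrite sumn_lam.
have [k [<- ck]] := tableau_box ii; exists k => //.
by rewrite mem_enum inE ck.
Qed.

(** All cycles have length 1 or 2, and [r = diag_length lam] of them have length 1. With [l] cycles
    in all, [d + r = 2 * l], so [d - l] is half of [d - r]. *)
Lemma odd_transpose : odd_perm t = odd ((d - diag_length lam)./2).
Proof.
rewrite -odd_cycle_type /odd_intpart.
have parts_t k : k \in parts (cycle_type t) -> (k == 1%N) || (k == 2%N).
  rewrite -has_pred1 has_count => c_gt0.
  have k_gt0 : (0 < k)%N.
    rewrite lt0n; apply: contraTneq c_gt0 => ->; rewrite -has_count has_pred1.
    by case/and3P: (partsP (cycle_type t)).
  have : (0 < #|cycle_pts t setT k|)%N by rewrite card_cycle_pts muln_gt0 k_gt0.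
  case/card_gt0P => z; rewrite !inE => /eqP <-.
  have : (#|porbit t z| %| 2)%N by rewrite -expg_fix_porbit expgS expg1 transposeK perm1.
  by case: #|_| => [|[|[|m]]] // /dvdn_leq.
have : (sumn (cycle_type t) + count_mem 1 (cycle_type t) = 2 * size (cycle_type t))%N.
  elim: (parts _) parts_t => //= k s IHs ks.
  have := ks k (mem_head _ _); have /IHs : forall k, k \in s -> (k == 1%N) || (k == 2%N).
    by move=> k' k's; apply: ks; rewrite inE k's orbT.
  by move=> IH /orP[]/eqP -> /=; lia.
case/and3P: (partsP (cycle_type t)) => _ _ /eqP ->.
have := card_cycle_pts t 1%N; rewrite card_fix_transpose mul1n => <-.
move=> dr; congr (odd _); lia.
Qed.

End Transposition.

Lemma row_group_set d (lam : intpart d) : group_set (row_group lam).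
Proof.
apply/group_setP; split; first by rewrite inE; apply/forallP => k; rewrite perm1.
move=> g h; rewrite !inE => /forallP gR /forallP hR; apply/forallP => k.
by rewrite permM (eqP (hR _)).
Qed.

Lemma col_group_set d (lam : intpart d) : group_set (col_group lam).
Proof.
apply/group_setP; split; first by rewrite inE; apply/forallP => k; rewrite perm1.
move=> g h; rewrite !inE => /forallP gR /forallP hR; apply/forallP => k.
by rewrite permM (eqP (hR _)).
Qed.

Lemma FS_specht d (lam : intpart d) (sgn := fun g : 'S_d => (-1) ^+ odd_perm g : algC) :
    self_conjugate lam -> mx_irreducible (specht_repr lam) ->
  \sum_(g : 'S_d) sgn g * \tr (specht_repr lam (g ^+ 2)%g)
    = (-1) ^+ ((d - diag_length lam)./2) * d`!%:R
  /\ \sum_(g : 'S_d) \tr (specht_repr lam (g ^+ 2)%g) = d`!%:R.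
Proof.
move=> lam_sc; have [t tP] := transpose_box lam_sc.
have sM g h : sgn (g * h)%g = sgn g * sgn h.
  by rewrite /sgn odd_permM signr_addb.
have s2 g : sgn g ^+ 2 = 1 by rewrite sqrr_sign.
(* The type of the representation depends on the symmetrizer, so a variable [y] stands for it until
   the equation with the product of twisted sums can be substituted. *)
have FS y : y = twisted_sum (fun=> 1) (Group (row_group_set lam))
                 *m twisted_sum sgn (Group (col_group_set lam)) ->
  let rho := submod_repr (cyclic_mx_module (regular_repr algC [set: 'S_d])
                            (gring_row y)) in
  mx_irreducible rho ->
  \sum_(g : 'S_d) sgn g * \tr (rho (g ^+ 2)%g) = sgn t * #|[set: 'S_d]|%:R
  /\ \sum_(g : 'S_d) \tr (rho (g ^+ 2)%g) = #|[set: 'S_d]|%:R.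
  move=> -> rho irr; apply: (FS_symmetrizer sM s2 _ _ irr).
    exact: transposeK tP.
  exact: transpose_row_group tP.
have -> : (-1) ^+ (d - diag_length lam)./2 = sgn t.
  by rewrite /sgn (odd_transpose tP) signr_odd.
rewrite -card_Sn -cardsT; apply: FS.
by congr (_ *m _); apply: eq_bigr => g _; rewrite scale1r.
Qed.

Theorem lemma9p6 (d n : nat) (rho : mx_representation algC [set: 'S_d]%g n)
    (lam : intpart d)
    (rho_irr : mx_irreducible rho)
    (rho_lam : mx_rsim rho (specht_repr lam))
    (lam_sc : self_conjugate lam) :
  (o_inv rho = 0 \/ o_inv rho = 1) /\
  eps rho = (-1) ^+ ((d - diag_length lam)./2)%N.
Proof.
have [sum_sgn sum_triv] := FS_specht lam_sc (mx_rsim_irr rho_lam rho_irr).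
set m := (_./2) in sum_sgn *.
have chiE g : cfRepr rho g = \tr (specht_repr lam g).
  by rewrite (cfRepr_sim rho_lam) cfunE inE.
have fact0 : d`!%:R != 0 :> algC by rewrite pnatr_eq0 -lt0n fact_gt0.
have oE : o_inv rho = (odd m)%:R.
  rewrite o_invE; apply: (canLR (mulfK fact0)).
  apply: (mulfI (_ : 2%:R != 0)); first by rewrite pnatr_eq0.
  (* Twice the sum over odd permutations is the sum of [(1 - sgn g) * chi (g ^+ 2)] over the whole
     group, the difference of the two sums of [FS_specht]. *)
  transitivity (d`!%:R - (-1) ^+ m * d`!%:R : algC).
    rewrite -sum_sgn -sum_triv -sumrB big_mkcond mulr_sumr; apply: eq_bigr => g _.
    rewrite chiE; case: odd_perm; first by rewrite expr1 mulN1r opprK mulr_natl.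
    by rewrite expr0 mul1r subrr mulr0.
  rewrite -signr_odd; case: (odd m); rewrite ?expr1 ?expr0.
    by rewrite mulN1r opprK mul1r mulr_natl.
  by rewrite mul1r subrr mul0r mulr0.
split; first by rewrite oE; case: odd; [right|left].
(* As [o_inv rho] is the natural number [odd m], the truncation in [eps] is exact. *)
by rewrite /eps oE natrK signr_odd.
Qed.
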